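(* For fixed $y\in\{0,1\}^{|J|}$, define $\widehat{L}(\cdot,y):[0,1]^{|J|}\to\mathbb{R}_+$ by $$\widehat{L}(x,y):=\sum_{i\in I}h_i\left(\frac{U_i^L+\sum_{j\in J}w_{ij}\bigl[-y_jx_j^2+(1+y_j)x_j\bigr]}{U_i^L+U_i^F+\sum_{j\in J}w_{ij}\bigl[(1-y_j)x_j+y_j\bigr]}\right).$$ Then $\widehat{L}(x,y)$ is concave in $x$. In addition, $\widehat{L}(x,y)=L(x,y)$ for all $x\in\{0,1\}^{|J|}$, where $$L(x,y):=\sum_{i\in I}h_i\left(\frac{U_i^L+\sum_{j\in J}w_{ij}x_j}{U_i^L+U_i^F+\sum_{j\in J}w_{ij}(x_j\vee y_j)}\right).$$
   Context: $I$ is a finite nonempty set of customer nodes; $J$ (candidate sites), $J^L$ and $J^F$ (pre-existing facilities of leader and follower) are finite pairwise disjoint sets. Demand weights $h_i\ge 0$ satisfy $\sum_{i\in I}h_i=1$. With real $\alpha_j$, distances $d_{ij}\ge0$ and $\beta>0$, set $w_{ij}:=\exp\{\alpha_j-\beta d_{ij}\}>0$ for $i\in I$, $j\in J\cup J^L\cup J^F$, and $U_i^L:=\sum_{j\in J^L}w_{ij}$, $U_i^F:=\sum_{j\in J^F}w_{ij}$. Notation: $a\vee b:=\max\{a,b\}$. *)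

(* Defs.v *)
From HB Require Import structures.
From mathcomp Require Import all_boot all_order all_algebra.
From mathcomp Require Import all_classical all_reals all_analysis.

Set Implicit Arguments.
Unset Strict Implicit.
Unset Printing Implicit Defensive.

Import Order.TTheory GRing.Theory Num.Theory.

Local Open Scope classical_set_scope.
Local Open Scope ring_scope.
Local Open Scope convex_scope.

(* Mirror image of [convex_function] of mathcomp.analysis.convex. *)
Definition concave_function (R : numFieldType) (E : lmodType R)
    (E' := convex_lmodType E) (D : set E') (f : E' -> R^o) : Prop :=
  forall (t : {i01 R}),
    {in D &, forall (x y : E'), (f x <| t |> f y <= f (x <| t |> y))%R}.

(* [R^o] rather than [R], so that vectors indexed by [J] form an
   [lmodType R]. *)
Definition unit_cube (R : realType) (J : finType) : set {ffun J -> R^o} :=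
  [set x : {ffun J -> R^o} | forall j, 0 <= x j <= 1].
Arguments unit_cube : clear implicits.

Definition binary_cube (R : realType) (J : finType) : set {ffun J -> R^o} :=
  [set x : {ffun J -> R^o} | forall j, x j = 0 \/ x j = 1].
Arguments binary_cube : clear implicits.

(* The candidate sites [J] and the pre-existing facilities [JL] (leader) and
   [JF] (follower) are arbitrary, possibly empty, finite types.  Their
   disjoint union is [J + JL + JF], i.e. [(J + JL) + JF], with injections
   [inl \o inl], [inl \o inr] and [inr]. *)

Definition weight (R : realType) (I J JL JF : finType)
    (alpha : J + JL + JF -> R) (beta : R) (d : I -> J + JL + JF -> R)
    (i : I) (j : J + JL + JF) : R :=
  expR (alpha j - beta * d i j).

Definition UL (R : realType) (I J JL JF : finType)
    (w : I -> J + JL + JF -> R) (i : I) : R :=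
  \sum_(j : JL) w i (inl (inr j)).

Definition UF (R : realType) (I J JL JF : finType)
    (w : I -> J + JL + JF -> R) (i : I) : R :=
  \sum_(j : JF) w i (inr j).

(* In [L] and [Lhat] the denominator of a summand is positive on the unit cube
   unless [JL] and [JF] are empty and [x = y = 0]; in that case the numerator
   vanishes too and the summand is [0 / 0 = 0]. *)

Definition L (R : realType) (I J JL JF : finType) (h : I -> R)
    (w : I -> J + JL + JF -> R) (x y : {ffun J -> R^o}) : R :=
  \sum_(i : I) h i *
    ((UL w i + \sum_(j : J) w i (inl (inl j)) * x j) /
     (UL w i + UF w i
      + \sum_(j : J) w i (inl (inl j)) * Num.max (x j : R) (y j : R))).

Definition Lhat (R : realType) (I J JL JF : finType) (h : I -> R)
    (w : I -> J + JL + JF -> R) (x y : {ffun J -> R^o}) : R :=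
  \sum_(i : I) h i *
    ((UL w i
      + \sum_(j : J) w i (inl (inl j)) * (- y j * x j ^+ 2 + (1 + y j) * x j)) /
     (UL w i + UF w i
      + \sum_(j : J) w i (inl (inl j)) * ((1 - y j) * x j + y j))).

(* Main.v *)
(** For binary [y], each numerator of [Lhat] equals the
    denominator [D] (affine in [x]) minus [UF + \sum_j w_j y_j (1 - x_j)^2], so
    each share is [D / D] minus a sum of quadratic-over-affine functions, which
    are convex. *)
Require Import Defs.
From HB Require Import structures.
From mathcomp Require Import all_boot all_order all_algebra.
From mathcomp Require Import all_classical all_reals all_analysis.
From mathcomp Require Import ring lra.

Import Order.TTheory GRing.Theory Num.Theory.

Local Open Scope classical_set_scope.
Local Open Scope ring_scope.

(** The gap is [(a - k * D) ^+ 2 / D]. The left side is linear in [(a, D)]: it is the tangent plane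
    of the quadratic-over-linear function along the ray [a = k * D]. *)
Lemma sqr_div_ge_tangent (R : realFieldType) (k a D : R) :
  0 < D -> 2 * k * a - k ^+ 2 * D <= a ^+ 2 / D.
Proof.
move=> D0; rewrite -subr_ge0.
have -> : a ^+ 2 / D - (2 * k * a - k ^+ 2 * D) = (a - k * D) ^+ 2 / D.
  by field; rewrite gt_eqF.
by rewrite divr_ge0 ?sqr_ge0 ?ltW.
Qed.

(* The bounds [c <= D1] and [c <= D2] allow a vanishing denominator only when
   [c = 0]. *)
Lemma quad_over_lin_convex (R : realFieldType) (t c a b D1 D2 : R) :
  0 <= t <= 1 -> 0 <= c -> c <= D1 -> c <= D2 ->
  c * (t * a + (1 - t) * b) ^+ 2 / (t * D1 + (1 - t) * D2) <=
  t * (c * a ^+ 2 / D1) + (1 - t) * (c * b ^+ 2 / D2).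
Proof.
move=> t01 c0 cD1 cD2.
have [->|cn0] := eqVneq c 0; first by rewrite !mul0r !mulr0 addr0.
have cp : 0 < c by rewrite lt0r cn0.
have D1p : 0 < D1 := lt_le_trans cp cD1.
have D2p : 0 < D2 := lt_le_trans cp cD2.
set m := t * a + _; set D := t * D1 + _.
have Dp : 0 < D.
  by apply: (lt_le_trans cp); case/andP: t01 => t0 t1; rewrite /D; nra.
(* With this [k] the tangent bound is an equality at [(m, D)]. Being linear, it then splits over the
   convex combination, and the bound applies at [(a, D1)] and [(b, D2)]. *)
have [k kE] : exists k, k = m / D by exists (m / D).
have -> : c * m ^+ 2 / D = c * (2 * k * m - k ^+ 2 * D).
  by rewrite kE; field; rewrite gt_eqF.
have -> : 2 * k * m - k ^+ 2 * D = t * (2 * k * a - k ^+ 2 * D1) +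
    (1 - t) * (2 * k * b - k ^+ 2 * D2) by rewrite /m /D; ring.
have -> : t * (c * a ^+ 2 / D1) + (1 - t) * (c * b ^+ 2 / D2) =
    c * (t * (a ^+ 2 / D1) + (1 - t) * (b ^+ 2 / D2)) by ring.
case/andP: t01 => t0 t1.
by rewrite ler_pM2l// lerD// ler_wpM2l ?subr_ge0// sqr_div_ge_tangent.
Qed.

(* As [0 / 0 = 0], [D / D] is the indicator of [D != 0]. *)
Lemma divff_concave (R : realFieldType) (t D1 D2 : R) :
  0 <= t <= 1 -> 0 <= D1 -> 0 <= D2 ->
  t * (D1 / D1) + (1 - t) * (D2 / D2) <=
  (t * D1 + (1 - t) * D2) / (t * D1 + (1 - t) * D2).
Proof.
move=> /andP[t0 t1] D1p D2p.
have [D0|Dn0] := eqVneq (t * D1 + (1 - t) * D2) 0.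
  (* A sum of nonnegative terms vanishes only if [t * D1] and [(1 - t) * D2] both do, so the left
     side is 0 as well. *)
  have u0 : 0 <= 1 - t by rewrite subr_ge0.
  move/eqP: (D0); rewrite paddr_eq0 ?mulr_ge0// => /andP[/eqP e1 /eqP e2].
  by rewrite D0 !mulrA e1 e2 !mul0r addr0.
have le1 (D : R) : D / D <= 1.
  by have [->|Dn] := eqVneq D 0; rewrite ?mul0r ?divff.
rewrite [leRHS]divff//.
by have := le1 D1; have := le1 D2; move: (D1 / D1) (D2 / D2) => p q; nra.
Qed.

(** The fraction captured from one customer in [Lhat], with [l] and [f] for [UL] and [UF]. Plain
    functions keep convex combinations free of the [convex_lmodType] structure. *)
Definition share {R : realFieldType} {J : finType} (w y : J -> R) (l f : R)
    (u : J -> R) : R :=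
  (l + \sum_j w j * (- y j * u j ^+ 2 + (1 + y j) * u j)) /
  (l + f + \sum_j w j * ((1 - y j) * u j + y j)).

Lemma share_concave (R : realFieldType) (J : finType) (w y x z : J -> R)
    (l f t : R) :
  0 <= t <= 1 -> 0 <= l -> 0 <= f -> (forall j, 0 <= w j) ->
  (forall j, y j = 0 \/ y j = 1) ->
  (forall j, 0 <= x j <= 1) -> (forall j, 0 <= z j <= 1) ->
  t * share w y l f x + (1 - t) * share w y l f z <=
  share w y l f (fun j => t * x j + (1 - t) * z j).
Proof.
move=> t01 l0 f0 w0 y01 x01 z01; set m := fun j => _.
pose D u := l + f + \sum_j w j * ((1 - y j) * u j + y j).
(* This rests on [- y * u ^+ 2 + (1 + y) * u = (1 - y) * u + y - y * (1 - u) ^+ 2]. The quotient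
   [D u / D u] stays as it is because [D u] may be 0. *)
have shareE u : share w y l f u =
    D u / D u - (f / D u + \sum_j w j * y j * (1 - u j) ^+ 2 / D u).
  rewrite -mulr_suml -mulrDl -mulrBl; congr (_ / _).
  have -> : \sum_j w j * (- y j * u j ^+ 2 + (1 + y j) * u j) =
      (\sum_j w j * ((1 - y j) * u j + y j) -
      \sum_j w j * y j * (1 - u j) ^+ 2).
    rewrite -sumrB; apply: eq_bigr => j _.
    by case: (y01 j) => ->; ring.
  by rewrite /D; ring.
have DE : D m = t * D x + (1 - t) * D z.
  rewrite /D !mulrDr !mulr_sumr addrACA -big_split/=.
  congr (_ + _); first by ring.
  by apply: eq_bigr => j _; rewrite /m; ring.
have y_ge0 j : 0 <= y j by case: (y01 j) => ->.
have y_le1 j : y j <= 1 by case: (y01 j) => ->.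
have term_ge0 u j : (forall j, 0 <= u j <= 1) ->
    0 <= w j * ((1 - y j) * u j + y j).
  by move=> /(_ j)/andP[u0 _]; rewrite mulr_ge0// addr_ge0// mulr_ge0// subr_ge0.
(* This bound and [wyD] control the coefficients [f] and [w j * y j] of the subtracted quotients, as
   [quad_over_lin_convex] requires. *)
have fD u : (forall j, 0 <= u j <= 1) -> f <= D u.
  move=> u01; rewrite /D [l + f]addrC -addrA lerDl addr_ge0// sumr_ge0// => j _.
  exact: term_ge0.
have wyD u j : (forall j, 0 <= u j <= 1) -> w j * y j <= D u.
  move=> u01; rewrite /D (bigD1 j)//= addrCA.
  apply: (@le_trans _ _ (w j * ((1 - y j) * u j + y j))).
    rewrite ler_wpM2l// lerDr mulr_ge0 ?subr_ge0//.
    by case/andP: (u01 j).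
  rewrite lerDl addr_ge0 ?addr_ge0// sumr_ge0// => k _.
  exact: term_ge0.
have D0 u : (forall j, 0 <= u j <= 1) -> 0 <= D u.
  by move=> /fD; apply: le_trans.
(* The case [a = b = 1] of the quadratic-over-linear inequality. *)
have fconv : f / D m <= t * (f / D x) + (1 - t) * (f / D z).
  have := @quad_over_lin_convex _ t f 1 1 _ _ t01 f0 (fD _ x01) (fD _ z01).
  by rewrite !mulr1 addrC subrK !expr1n !mulr1 -DE.
have qconv : \sum_j w j * y j * (1 - m j) ^+ 2 / D m <=
    t * (\sum_j w j * y j * (1 - x j) ^+ 2 / D x) +
    (1 - t) * (\sum_j w j * y j * (1 - z j) ^+ 2 / D z).
  rewrite !mulr_sumr -big_split/=; apply: ler_sum => j _.
  have -> : 1 - m j = t * (1 - x j) + (1 - t) * (1 - z j) by rewrite /m; ring.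
  by rewrite DE; apply: quad_over_lin_convex; rewrite ?mulr_ge0 ?wyD.
have dconv := @divff_concave _ t _ _ t01 (D0 _ x01) (D0 _ z01).
rewrite -DE in dconv.
rewrite !shareE !mulrBr !mulrDr; lra.
Qed.

Theorem proposition4 (R : realType) (I J JL JF : finType)
    (h : I -> R) (alpha : J + JL + JF -> R) (beta : R)
    (d : I -> J + JL + JF -> R)
    (I_gt0 : (0 < #|I|)%N)
    (h_ge0 : forall i, 0 <= h i)
    (h_sum1 : \sum_(i : I) h i = 1)
    (d_ge0 : forall i j, 0 <= d i j)
    (beta_gt0 : 0 < beta)
    (y : {ffun J -> R^o}) (y01 : binary_cube R J y) :
  let w := weight alpha beta d in
  [/\ forall x, unit_cube R J x -> 0 <= Lhat h w x y,
      concave_function (unit_cube R J) (fun x => Lhat h w x y)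
    & forall x, binary_cube R J x -> Lhat h w x y = L h w x y].
Proof.
move=> w.
have w0 i j : 0 <= w i j by exact: expR_ge0.
have UL0 i : 0 <= UL w i by rewrite sumr_ge0.
have UF0 i : 0 <= UF w i by rewrite sumr_ge0.
split.
- move=> x x01; rewrite /Lhat sumr_ge0// => i _.
  (* For [y j = 1] the bracket in the numerator is [x j * (2 - x j)], nonnegative on the unit
     interval. *)
  rewrite mulr_ge0// divr_ge0// !addr_ge0// sumr_ge0// => j _;
    rewrite mulr_ge0//; have /andP[] := x01 j; case: (y01 j) => ->; nra.
- move=> t x z; rewrite !inE => x01 z01.
  have t01 : 0 <= (t%:num : R) <= 1 by rewrite ge0 le1.
  (* The abstract convex combination is evaluated coordinatewise, to match the form in
     [share_concave]. *)
  have mE : (conv t x z : {ffun J -> R^o}) =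
      (fun j => t%:num * x j + (1 - t%:num) * z j) :> (J -> R).
    by apply/funext => j; rewrite /conv/= !ffunE.
  rewrite convRE /Lhat !mulr_sumr -big_split/=.
  apply: ler_sum => i _.
  rewrite mulrCA [X in _ + X]mulrCA -mulrDr ler_wpM2l//.
  have := @share_concave R J (fun j => w i (inl (inl j))) y x z _ _ _ t01
    (UL0 i) (UF0 i) (fun j => w0 i _) y01 x01 z01.
  by rewrite -mE.
- move=> x x01; rewrite /Lhat /L; apply: eq_bigr => i _.
  (* On binary values the numerator bracket reduces to [x j] and the denominator bracket to
     [x j + y j - x j * y j], which is the maximum. Numerators and denominators agree separately,
     which covers [0 / 0] too. *)
  congr (_ * ((_ + _) / (_ + _))); apply: eq_bigr => j _; congr (_ * _);
    case: (x01 j) (y01 j) => -> [] ->;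
    rewrite ?maxxx ?(max_l ler01) ?(max_r ler01); ring.
Qed.
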